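(* Let $X$ be a complex Banach space, and let $(A,A(\cdot))$ and $(B,B(\cdot))$ be two pairs each satisfying conditions (a1)–(a4) listed in the context. Let $\psi\colon\mathbb{D}\to\mathbb{C}$ be an analytic function that is nonzero (i.e. $\psi(z)\neq 0$ for some $z\in\mathbb{D}$) and let $\varphi\colon\mathbb{D}\to\mathbb{D}$ be analytic. Let $W_{\psi,\varphi}$ and $\widetilde{W}_{\psi,\varphi}$ denote the weighted composition operators $f\mapsto\psi\cdot(f\circ\varphi)$ acting on scalar-valued and on $X$-valued analytic functions, respectively. (1) If $\widetilde{W}_{\psi,\varphi}$ is bounded $A(X)\to B(X)$, then $W_{\psi,\varphi}$ is bounded $A\to B$. (2) If $\widetilde{W}_{\psi,\varphi}\colon A(X)\to B(X)$ belongs to an operator ideal, then the identity operator $I_X\colon X\to X$ and $W_{\psi,\varphi}\colon A\to B$ belong to the same operator ideal.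
   Context: $\mathbb{D}$ is the open unit disc in $\mathbb{C}$. For $\psi\colon\mathbb{D}\to\mathbb{C}$ analytic and $\varphi\colon\mathbb{D}\to\mathbb{D}$ analytic, the weighted composition operator is $f\mapsto\psi\cdot(f\circ\varphi)$, i.e. $z\mapsto\psi(z)f(\varphi(z))$; it is written $W_{\psi,\varphi}$ on scalar-valued analytic functions and $\widetilde{W}_{\psi,\varphi}$ on $X$-valued analytic functions. ''Bounded $A\to B$'' means that the operator maps $A$ into $B$ and is a bounded linear operator between them. A pair $(A,A(\cdot))$ consists of a Banach space $A$ of analytic functions $\mathbb{D}\to\mathbb{C}$ and, for each complex Banach space $X$, an associated Banach space $A(X)$ of analytic functions $\mathbb{D}\to X$. The following conditions are required for all complex Banach spaces $X$: (a1) The constant maps $f(z)\equiv c$ belong to $A$ for all $c\in\mathbb{C}$. (a2) For every $x\in X$, $f\mapsto f\otimes x$ defines a bounded linear operator $A\to A(X)$, where $(f\otimes x)(z)=f(z)x$. (a3) For every $x^*\in X^*$, $f\mapsto x^*\circ f$ defines a bounded linear operator $A(X)\to A$. (a4) For every $z\in\mathbb{D}$, the point evaluation $f\mapsto f(z)$ is bounded $A(X)\to X$. An operator ideal (in the sense of Pietsch) is a class $\mathcal{I}$ of bounded linear operators between complex Banach spaces such that, for all Banach spaces $U,V$, the set $\mathcal{I}(U,V)$ of members of $\mathcal{I}$ acting from $U$ to $V$ is a linear subspace of $L(U,V)$ (the bounded linear operators from $U$ to $V$) containing the finite rank operators, and $RTS\in\mathcal{I}(U_0,V_0)$ whenever $S\in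 L(U_0,U)$, $T\in\mathcal{I}(U,V)$, $R\in L(V,V_0)$.
   Formalization: The Banach space X is assumed to be nonzero; for X = {0} the X-valued operator is always zero, hence bounded and of finite rank, while the scalar operator W need not map A into B (e.g. A = H^2, B = H^infinity, psi = 1, phi = id). *)

(* Defs.v *)
(* The complex numbers are [R[i]] for an arbitrary [R : realType]; Banach spaces
   are complex, i.e. terms of [completeNormedModType R[i]]. *)
From HB Require Import structures.
From mathcomp Require Import all_boot all_order all_algebra.
From mathcomp Require Import complex.
From mathcomp Require Import all_classical all_reals all_analysis.

Set Implicit Arguments.
Unset Strict Implicit.
Unset Printing Implicit Defensive.

Import Order.TTheory GRing.Theory Num.Theory.
Import numFieldNormedType.Exports.

Local Open Scope classical_set_scope.
Local Open Scope ring_scope.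
Local Open Scope complex_scope.

Definition disc (R : realType) : Type := {z : R[i] | `|z| < 1}.

(* Complex differentiability at every point of the open disc.  The extension
   [F] only serves to use the library's [derivable]; its values outside the
   disc are irrelevant. *)
Definition analytic (R : realType) (X : normedModType R[i]) (f : disc R -> X) :
    Prop :=
  exists2 F : R[i]^o -> X,
    (forall z : R[i]^o, `|z| < 1 -> derivable F z 1) &
    (forall z : disc R, f z = F (\val z)).

Definition bounded_linear (R : realType) (U V : normedModType R[i]) :
    set (U -> V) :=
  [set T | linear T /\ exists M : R, forall x : U, `|T x| <= M%:C * `|x|].

(* A Banach space of analytic functions from the disc to [X]: a linear space of
   such functions with its own complete norm, encoded as an abstract Banach
   space realised as functions by the injective linear map [ev]. *)
Record anspace (R : realType) (X : normedModType R[i]) := Anspace {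
  anspace_sort :> completeNormedModType R[i];
  ev : anspace_sort -> disc R -> X;
  ev_linear : forall (a : R[i]) (f g : anspace_sort) (z : disc R),
    ev (a *: f + g) z = a *: ev f z + ev g z;
  ev_inj : forall f g : anspace_sort, (forall z, ev f z = ev g z) -> f = g;
  ev_analytic : forall f : anspace_sort, analytic (ev f) }.

Record anpair (R : realType) := Anpair {
  scalar_space : anspace R[i]^o;
  vector_space : forall X : completeNormedModType R[i], anspace X }.

Record admissible (R : realType) (A : anpair R) : Prop := Admissible {
  admissible_cst : forall c : R[i],
    exists f : scalar_space A, forall z, ev f z = c;
  admissible_tensor : forall (X : completeNormedModType R[i]) (x : X),
    exists2 T : scalar_space A -> vector_space A X,
      bounded_linear T & forall f z, ev (T f) z = ev f z *: x;
  admissible_dual : forall (X : completeNormedModType R[i]) (l : X -> R[i]^o),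
    bounded_linear l ->
    exists2 T : vector_space A X -> scalar_space A,
      bounded_linear T & forall f z, ev (T f) z = l (ev f z);
  admissible_eval : forall (X : completeNormedModType R[i]) (z : disc R),
    bounded_linear (fun f : vector_space A X => ev f z) }.

Definition finite_rank (R : realType) (U V : normedModType R[i]) (T : U -> V) :
    Prop :=
  exists (n : nat) (v : 'I_n -> V),
    forall x : U, exists c : 'I_n -> R[i], T x = \sum_(i < n) c i *: v i.

Definition opclass (R : realType) : Type :=
  forall U V : completeNormedModType R[i], set (U -> V).

Record operator_ideal (R : realType) (I : opclass R) : Prop := OperatorIdeal {
  ideal_bounded : forall U V : completeNormedModType R[i],
    I U V `<=` @bounded_linear R U V;
  ideal_linear : forall (U V : completeNormedModType R[i]) (a : R[i])
      (S T : U -> V),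
    I U V S -> I U V T -> I U V (fun x => a *: S x + T x);
  ideal_finite_rank : forall (U V : completeNormedModType R[i]) (T : U -> V),
    bounded_linear T -> finite_rank T -> I U V T;
  ideal_comp : forall (U0 U V V0 : completeNormedModType R[i])
      (S : U0 -> U) (T : U -> V) (Q : V -> V0),
    bounded_linear S -> I U V T -> bounded_linear Q ->
    I U0 V0 (Q \o T \o S) }.

(* The weighted composition operator [f |-> psi * (f \o phi)] maps [E] into [F],
   and the resulting operator, unique by [ev_inj], lies in [P]. *)
Definition wco_in (R : realType) (X : normedModType R[i])
    (psi : disc R -> R[i]^o) (phi : disc R -> disc R) (E F : anspace X)
    (P : set (E -> F)) : Prop :=
  exists2 T : E -> F, P T & forall f z, ev (T f) z = psi z *: ev f (phi z).

(* Main.v *)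
(* If [l] is a bounded functional with [l x = 1], then [W] is the composition of
   [f |-> f (x) x], [W~] and [f |-> l o f]; such an [l] is given by the
   Hahn-Banach theorem.  If [psi z != 0], then [I_X] is the composition of
   [J], [W~] and [psi(z)^-1 ev_z], where [J x] is the constant function [x];
   [J] is bounded by the closed graph theorem, which a gliding hump argument
   gives without Baire's theorem. *)
Require Import Defs.
From HB Require Import structures.
From mathcomp Require Import all_boot all_order all_algebra.
From mathcomp Require Import complex.
From mathcomp Require Import ring lra.
From mathcomp Require Import all_classical all_reals all_analysis.

Set Implicit Arguments.
Unset Strict Implicit.
Unset Printing Implicit Defensive.

Import Order.TTheory GRing.Theory Num.Theory.
Import numFieldNormedType.Exports.

Local Open Scope classical_set_scope.
Local Open Scope ring_scope.
Local Open Scope complex_scope.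

(** * Real-valued norms and geometric convergence *)

Section RealNorm.
Variable R : realType.
Implicit Type V : normedModType R[i].

(** The norm takes values in [R[i]]; passing to its real part makes the real order and [lra]
    available. *)
Definition rnorm V (x : V) : R := complex.Re `|x|.

Lemma rnormE V (x : V) : `|x| = (rnorm x)%:C.
Proof. by rewrite /rnorm RRe_real// ger0_real. Qed.

Lemma rnorm_ge0 V (x : V) : 0 <= rnorm x.
Proof. by rewrite -ler0c -rnormE. Qed.

Lemma rnorm0 V : rnorm (0 : V) = 0.
Proof. by rewrite /rnorm normr0. Qed.

Lemma rnorm_eq0 V (x : V) : (rnorm x == 0) = (x == 0).
Proof. by rewrite -[RHS]normr_eq0 rnormE -(inj_eq (@complexI R)). Qed.

Lemma rnormN V (x : V) : rnorm (- x) = rnorm x.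
Proof. by rewrite /rnorm normrN. Qed.

Lemma rnormD V (x y : V) : rnorm (x + y) <= rnorm x + rnorm y.
Proof. by rewrite -lecR rmorphD /= -!rnormE ler_normD. Qed.

Lemma rnormB V (x y : V) : rnorm (x - y) <= rnorm x + rnorm y.
Proof. by rewrite -(rnormN y) rnormD. Qed.

Lemma rnormZ V (t : R) (x : V) : rnorm (t%:C *: x) = `|t| * rnorm x.
Proof.
apply: (@complexI R); rewrite -rnormE normrZ normc_def.
by rewrite expr0n addr0 sqrtr_sqr rnormE -rmorphM.
Qed.

Lemma rnormZi V (x : V) : rnorm ('i *: x) = rnorm x.
Proof.
by rewrite /rnorm normrZ normc_def expr0n expr1n add0r sqrtr1 mul1r.
Qed.

Lemma cvg_rnormP V (u : nat -> V) (l : V) :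
  (u n @[n --> \oo] --> l) <->
  forall e : R, 0 < e -> exists N, forall n, (N <= n)%N -> rnorm (l - u n) < e.
Proof.
split=> [/cvgrPdist_lt ul e e0|ul].
  have /ul[N _ uN] : 0 < e%:C by rewrite ltcR.
  by exists N => n Nn; rewrite -ltcR -rnormE; exact: uN.
apply/cvgrPdist_lt => e e0.
(* A positive element of [R[i]] is real, so real tolerances suffice. *)
have eE : e = (complex.Re e)%:C by rewrite RRe_real// gtr0_real.
rewrite eE ltcR in e0 *; have [N uN] := ul _ e0.
by exists N => // n /uN; rewrite -ltcR -rnormE.
Qed.

(** For [q <= 1/2], induction gives [q ^+ n <= 1/(n+1)], and the Archimedean property concludes. *)
Lemma exists_expr_lt (q C e : R) : 0 <= q <= 2^-1 -> 0 < e ->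
  exists N, forall n, (N <= n)%N -> C * q ^+ n < e.
Proof.
move=> /andP[q0 q1] e0.
have q2 n : `|C| * q ^+ n <= `|C| / n.+1%:R.
  rewrite ler_wpM2l//; elim: n => [|n IH]; first by rewrite expr0 invr1.
  rewrite exprS (le_trans (ler_pM q0 (exprn_ge0 _ q0) q1 IH))//.
  rewrite -invfM lef_pV2 ?posrE//.
  by rewrite -natrM ler_nat mul2n -addnn addSn addnS !ltnS leq_addr.
exists (Num.truncn (`|C| / e)) => n Nn.
apply: le_lt_trans (_ : _ <= `|C| * q ^+ n) _.
  by rewrite ler_wpM2r ?exprn_ge0// ler_norm.
apply: le_lt_trans (q2 n) _.
rewrite ltr_pdivrMr// mulrC -ltr_pdivrMr//.
by apply: lt_le_trans (truncnS_gt _) _; rewrite ler_nat.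
Qed.

(** Telescoping and completeness; the factor 2 bounds [1/(1-q)]. *)
Lemma geometric_cvg (V : completeNormedModType R[i]) (s : nat -> V) (q C : R) :
  0 <= C -> 0 <= q <= 2^-1 ->
  (forall n, rnorm (s n.+1 - s n) <= C * q ^+ n) ->
  exists2 l, s n @[n --> \oo] --> l &
    forall n, rnorm (l - s n) <= 2 * C * q ^+ n.
Proof.
move=> C0 q01 sq; have /andP[q0 q1] := q01.
(* Subtracting [q ^+ (k + n)] makes the induction close: the step leaves the slack
   [C * q ^+ (k + n) * (1 - 2 * q)]. *)
have sB n k : rnorm (s (k + n)%N - s n) <= 2 * C * (q ^+ n - q ^+ (k + n)).
  elim: k => [|k IH]; first by rewrite !subrr rnorm0 mulr0.
  have -> : s (k.+1 + n)%N - s n =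
      (s (k.+1 + n)%N - s (k + n)%N) + (s (k + n)%N - s n).
    by rewrite addrA subrK.
  apply: le_trans (rnormD _ _) _.
  apply: le_trans (lerD (sq (k + n)%N) IH) _.
  have : 0 <= C * q ^+ (k + n) * (1 - 2 * q).
    by rewrite !mulr_ge0 ?exprn_ge0//; lra.
  by rewrite addSn exprS; lra.
have sB' n m : (n <= m)%N -> rnorm (s m - s n) <= 2 * C * q ^+ n.
  move=> /subnK <-; apply: le_trans (sB _ _) _.
  by rewrite ler_wpM2l ?mulr_ge0// lerBlDr lerDl exprn_ge0.
have /cvg_ex[l sl] : cvg (s n @[n --> \oo]).
  apply: cauchy_cvg; apply: cauchy_exP => e e0.
  have eE : e = (complex.Re e)%:C by rewrite RRe_real// gtr0_real.
  rewrite eE ltcR in e0 *.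
  have [N sN] := exists_expr_lt (2 * C) q01 e0.
  exists (s N); exists N => // n /= Nn.
  rewrite -ball_normE /ball_ /= rnormE ltcR -rnormN opprB.
  exact: le_lt_trans (sB' _ _ Nn) (sN _ (leqnn _)).
exists l => // n; apply/ler_addgt0Pr => e e0.
have /cvg_rnormP/(_ _ e0)[N sN] := sl.
have := sN _ (leq_maxl N n); have := sB' _ _ (leq_maxr N n).
have := rnormD (l - s (maxn N n)) (s (maxn N n) - s n).
by rewrite addrA subrK; lra.
Qed.

End RealNorm.

(** * Bounded linear operators *)

Lemma bounded_linear_rnorm (R : realType) (U V : normedModType R[i])
    (T : U -> V) (M : R) :
  linear T -> (forall x, rnorm (T x) <= M * rnorm x) -> bounded_linear T.
Proof.
move=> linT TM; split=> //; exists M => x.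
by rewrite !rnormE -rmorphM lecR.
Qed.

Lemma bounded_linear_comp (R : realType) (U V W : normedModType R[i])
    (S : V -> W) (T : U -> V) :
  bounded_linear S -> bounded_linear T -> bounded_linear (S \o T).
Proof.
move=> [linS [M SM]] [linT [N TN]].
(* Bounds are not assumed nonnegative, hence the absolute values. *)
apply: (@bounded_linear_rnorm _ _ _ _ (`|M| * `|N|)) => [a x y|x] /=.
  by rewrite linT linS.
have : rnorm (S (T x)) <= M * rnorm (T x) by rewrite -lecR rmorphM /= -!rnormE.
have : rnorm (T x) <= N * rnorm x by rewrite -lecR rmorphM /= -!rnormE.
move=> TxN /le_trans; apply; rewrite -mulrA.
apply: le_trans (ler_wpM2r (rnorm_ge0 _) (ler_norm M)) _.
apply: ler_wpM2l => //; apply: le_trans TxN _.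
by rewrite ler_wpM2r ?rnorm_ge0// ler_norm.
Qed.

Lemma bounded_linear_cvg (R : realType) (U V : normedModType R[i])
    (T : U -> V) (u : nat -> U) (l : U) :
  bounded_linear T -> u n @[n --> \oo] --> l -> T (u n) @[n --> \oo] --> T l.
Proof.
move=> [linT [M TM]] /cvg_rnormP ul; apply/cvg_rnormP => e e0.
have M0 : 0 < `|M| + 1 by rewrite ltr_wpDl.
have [N uN] := ul _ (divr_gt0 e0 M0).
exists N => n /uN; rewrite ltr_pdivlMr// => /(le_lt_trans _); apply.
have -> : T l - T (u n) = T (l - u n).
  by rewrite [l - _]addrC -[- u n]scaleN1r linT scaleN1r addrC.
have : rnorm (T (l - u n)) <= M * rnorm (l - u n).
  by rewrite -lecR rmorphM /= -!rnormE.
move=> /le_trans; apply; rewrite mulrC ler_wpM2l ?rnorm_ge0//.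
by rewrite (le_trans (ler_norm M))// lerDl.
Qed.

Lemma bounded_linear_scale (R : realType) (V : normedModType R[i]) (a : R[i]) :
  bounded_linear (fun x : V => a *: x).
Proof.
split=> [b x y|]; first by rewrite scalerDr !scalerA mulrC.
by exists (complex.Re `|a|) => x; rewrite normrZ RRe_real// ger0_real.
Qed.

(** * Closed graph theorem *)

Section ClosedGraph.
Variables (R : realType) (U V : completeNormedModType R[i]) (T : U -> V).
Hypothesis linT : linear T.

Let linD x y : T (x + y) = T x + T y.
Proof. by rewrite -[x]scale1r linT !scale1r. Qed.

Let T0 : T 0 = 0.
Proof. by apply: (addrI (T 0)); rewrite -linD !addr0. Qed.

Let linZ a x : T (a *: x) = a *: T x.
Proof. by rewrite -[a *: x]addr0 linT T0 addr0. Qed.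

Let linB x y : T (x - y) = T x - T y.
Proof. by rewrite -scaleN1r linD linZ scaleN1r. Qed.

(* Otherwise there are unit vectors [u n] such that [T] is huge on the ball of
   radius [1/2] around [u n], how huge being chosen after the partial sum
   [s n = \sum_(k < n) 4^-k u k].  The limit [l] of [s] is so close to
   [s n.+1 = s n + 4^-n u n] that [|T l| > n], for every [n]. *)
Lemma almost_bounded : exists2 M : R, 0 <= M &
  forall x, exists2 y,
    rnorm (x - y) <= rnorm x / 2 & rnorm (T y) <= M * rnorm x.
Proof.
apply: contrapT => noM.
(* If every unit vector had an approximation with image bounded by [M], rescaling would give the
   lemma with constant [|M|]. *)
have bad (M : R) : exists2 x, rnorm x = 1 &
    forall y, rnorm (x - y) <= 2^-1 -> M < rnorm (T y).
  apply: contrapT => nox; apply: noM; exists `|M| => // x.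
  have [->|x0] := eqVneq x 0.
    by exists 0; rewrite ?subr0 ?T0 !rnorm0 ?mul0r ?mulr0.
  have nx0 : 0 < rnorm x by rewrite lt_neqAle rnorm_ge0 eq_sym rnorm_eq0 x0.
  apply: contrapT => noy; apply: nox; exists ((rnorm x)^-1%:C *: x).
    by rewrite rnormZ gtr0_norm ?invr_gt0// mulVf ?gt_eqF.
  move=> y xy; rewrite ltNge; apply/negP => TyM.
  have yE : y = (rnorm x)^-1%:C *: ((rnorm x)%:C *: y).
    by rewrite scalerA -rmorphM mulVf ?gt_eqF// scale1r.
  apply: noy; exists ((rnorm x)%:C *: y).
    move: xy; rewrite {1}yE -scalerBr rnormZ gtr0_norm ?invr_gt0//.
    by rewrite mulrC ler_pdivrMr// mulrC.
  rewrite linZ rnormZ gtr0_norm// mulrC ler_wpM2r ?rnorm_ge0//.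
  exact: le_trans TyM (ler_norm _).
(* The choice depends on the pair (partial sum, index), so that [s] can be defined by recursion. *)
have /choice[u uP] (xn : U * nat) : exists u : U, rnorm u = 1 /\
    forall y, rnorm (u - y) <= 2^-1 ->
      (rnorm (T xn.1) + xn.2%:R) * 4 ^+ xn.2 < rnorm (T y).
  by have [u u1 uM] := bad ((rnorm (T xn.1) + xn.2%:R) * 4 ^+ xn.2); exists u.
pose s := fix s n :=
  if n is m.+1 then s m + (4^-1 ^+ m)%:C *: u (s m, m) else 0.
have sS n : s n.+1 - s n = (4^-1 ^+ n)%:C *: u (s n, n).
  by rewrite /= addrC addKr.
have q0 n : 0 < 4^-1 ^+ n :> R by rewrite exprn_gt0// invr_gt0.
have sq n : rnorm (s n.+1 - s n) <= 1 * 4^-1 ^+ n.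
  by rewrite sS rnormZ (uP _).1 mulr1 mul1r gtr0_norm.
have [||l _ sl] := geometric_cvg _ _ sq; [by []|by apply/andP; split; lra|].
(* The error bound [2 * 4^-(n+1)] at [s n.+1] puts [4^n (l - s n)] within 1/2 of [u (s n, n)]. Hence
   [|T (l - s n)| > |T (s n)| + n]. *)
have Tl n : n%:R < rnorm (T l).
  have [_ /(_ ((4 ^+ n)%:C *: (l - s n)))] := uP (s n, n).
  have qE : u (s n, n) = (4 ^+ n)%:C *: (s n.+1 - s n).
    by rewrite sS scalerA -rmorphM -exprMn divff// expr1n scale1r.
  have p0 : 0 < 4 ^+ n :> R by rewrite exprn_gt0.
  rewrite {1}qE -scalerBr opprB addrA subrK linZ !rnormZ !gtr0_norm//= => H.
  have : 4 ^+ n * rnorm (s n.+1 - l) <= 2^-1.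
    rewrite -rnormN opprB mulrC -ler_pdivlMr//.
    apply: le_trans (sl n.+1) _.
    by rewrite exprS exprVn; lra.
  move=> /H; rewrite mulrC ltr_pM2l// linB => {}H.
  by have := rnormB (T l) (T (s n)); lra.
have := Tl (Num.truncn (rnorm (T l))).+1.
by apply/negP; rewrite -leNgt; apply/ltW/truncnS_gt.
Qed.

(** Approximating [x], then the remainder, and so on, writes [x] as a series whose image under [T]
    converges geometrically; closedness identifies the sum of the images with [T x]. *)
Theorem closed_graph :
  (forall (u : nat -> U) x y, u n @[n --> \oo] --> x ->
     T (u n) @[n --> \oo] --> y -> y = T x) ->
  bounded_linear T.
Proof.
move=> closedT; have [M M0 approx] := almost_bounded.
have /choice[h hP] x :
    exists y, rnorm (x - y) <= rnorm x / 2 /\ rnorm (T y) <= M * rnorm x.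
  by have [y] := approx x; exists y.
apply: (@bounded_linear_rnorm _ _ _ _ (2 * M)) => // x.
(* The remainder after [n] approximations; [x - e n] is the sum of the first [n] approximants
   [h (e k)]. *)
pose e n := iter n (fun y => y - h y) x.
have e_le n : rnorm (e n) <= rnorm x * 2^-1 ^+ n.
  elim: n => [|n IH]; first by rewrite expr0 mulr1.
  by rewrite exprS /=; have := (hP (e n)).1; rewrite -/(e n); lra.
have half : 0 <= (2^-1 : R) <= 2^-1 by rewrite lexx invr_ge0 ler0n.
have xe : x - e n @[n --> \oo] --> x.
  apply/cvg_rnormP => d d0; have [N Nd] := exists_expr_lt (rnorm x) half d0.
  exists N => n /Nd; apply: le_lt_trans.
  by rewrite opprB addrCA subrr addr0.
have Te n : rnorm (T (x - e n.+1) - T (x - e n)) <= M * rnorm x * 2^-1 ^+ n.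
  have -> : T (x - e n.+1) - T (x - e n) = T (h (e n)).
    rewrite -linB [e n.+1]/= -/(e n); congr T.
    by rewrite !opprB addrC addrA subrK addrCA subrr addr0.
  by apply: le_trans (hP _).2 _; rewrite -mulrA ler_wpM2l.
have [|l Tl lP] := geometric_cvg _ half Te.
  by rewrite mulr_ge0 ?rnorm_ge0.
rewrite -(closedT _ _ _ xe Tl).
(* Since [e 0 = x], the error bound at index 0 is the bound [2 * M * |x|] on the limit itself. *)
by have := lP 0%N; rewrite subrr T0 subr0 expr0 mulr1 mulrA.
Qed.

End ClosedGraph.

(** * Hahn-Banach theorem, first over the reals, then over the complex numbers *)

Section HahnBanach.
Variables (R : realType) (X : normedModType R[i]) (x0 : X).

(* Graphs of partial real-linear functionals.  The empty graph is admitted, as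
   the union of the empty chain; hence the shape of the last clause. *)
Let partial_functional (G : set (X * R)) : Prop :=
  [/\ forall t x a y b, G (x, a) -> G (y, b) -> G (t%:C *: x + y, t * a + b),
      forall x a, G (x, a) -> a <= rnorm x
    & forall x a, G (x, a) -> G (x0, rnorm x0)].

Let bigcup_partial_functional (F : set (set (X * R))) :
  F `<=` partial_functional -> total_on F subset ->
  partial_functional (\bigcup_(G in F) G).
Proof.
move=> FP Ftot; split=> [t x a y b [G FG Gx] [H FH Hy]|x a [G FG]|x a [G FG]].
- have [GH|HG] := Ftot _ _ FG FH.
    by exists H => //; have [+ _ _] := FP _ FH; apply; [exact: GH|].
  by exists G => //; have [+ _ _] := FP _ FG; apply; [|exact: HG].
- by have [_ + _] := FP _ FG; apply.
- by move=> Gx; exists G => //; have [_ _ +] := FP _ FG; apply; exact: Gx.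
Qed.

Let line_partial_functional :
  partial_functional (range (fun t : R => (t%:C *: x0, t * rnorm x0))).
Proof.
split=> [t x a y b [u _ [<- <-]] [v _ [<- <-]]|x a [u _ [<- <-]]|_ _ _].
- exists (t * u + v) => //; congr pair; last by rewrite mulrDl mulrA.
  by rewrite scalerA -scalerDl rmorphD rmorphM.
- by rewrite rnormZ ler_wpM2r ?rnorm_ge0// ler_norm.
- by exists 1 => //; rewrite scale1r mul1r.
Qed.

Section Extension.
Variable G : set (X * R).
Hypotheses (Gfun : partial_functional G) (Gx0 : G !=set0).
Variable z : X.

Let Gadd t x a y b : G (x, a) -> G (y, b) -> G (t%:C *: x + y, t * a + b).
Proof. by have [+ _ _] := Gfun; apply. Qed.

Let Gle x a : G (x, a) -> a <= rnorm x.
Proof. by have [_ + _] := Gfun; apply. Qed.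

Let G0 : G (0, 0).
Proof.
have [[x a] Gx] := Gx0; have := Gadd (-1) Gx Gx.
by rewrite rmorphN1 scaleN1r mulN1r !addNr.
Qed.

Let Gscale t x a : G (x, a) -> G (t%:C *: x, t * a).
Proof. by move=> Gx; have := Gadd t Gx G0; rewrite !addr0. Qed.

(** A value at [z] keeps the extension dominated by the norm iff it lies between all [a - |x - z|]
    and all [|x + z| - a], for [(x, a)] in [G]; [c] is the least such value. *)
Let slopes : set R := [set r | exists w, G w /\ r = w.2 - rnorm (w.1 - z)].
Let c := sup slopes.

Let slopes_le w : G w -> ubound slopes (rnorm (w.1 + z) - w.2).
Proof.
case: w => y b Gy _ [[x a] [Gx ->]] /=.
have := Gle (Gadd 1 Gx Gy); rewrite scale1r mul1r.
have := rnormD (x - z) (y + z).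
by rewrite [y + z]addrC addrA subrK [z + y]addrC; lra.
Qed.

Let c_le x a : G (x, a) -> c <= rnorm (x + z) - a.
Proof.
move=> Gx; apply: ge_sup; last exact: (slopes_le Gx).
by exists (a - rnorm (x - z)); exists (x, a).
Qed.

Let c_ge x a : G (x, a) -> a - rnorm (x - z) <= c.
Proof.
move=> Gx; apply: sup_upper_bound; last by exists (x, a).
split; last by exists (rnorm (x + z) - a); exact: (slopes_le Gx).
by exists (a - rnorm (x - z)); exists (x, a).
Qed.

Lemma extend_partial_functional :
  exists H, [/\ partial_functional H, G `<=` H & exists a, H (z, a)].
Proof.
exists [set v | exists w (t : R), G w /\ v = (w.1 + t%:C *: z, w.2 + t * c)].
split.
- split=> [t _ _ _ _ [[x a] [u [Gx [-> ->]]]] [[y b] [v [Gy [-> ->]]]]|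
           _ _ [[x a] [t [Gx [-> ->]]]]|x a [w [t [Gw _]]]] /=.
  + exists (t%:C *: x + y, t * a + b), (t * u + v); split; first exact: Gadd.
    congr pair => /=; last by ring.
    by rewrite rmorphD rmorphM scalerDl scalerDr scalerA addrACA.
  (* Dividing by [|t|] reduces domination at [x + t z] to the lower bound on [c] if [t < 0] and to
     the upper bound if [t > 0]. *)
  + have [t0|t0|->] := ltgtP t 0; last by rewrite scale0r mul0r !addr0 Gle.
    * have nt : 0 < - t by rewrite oppr_gt0.
      have := c_ge (Gscale (- t)^-1 Gx).
      have -> : x + t%:C *: z = (- t)%:C *: ((- t)^-1%:C *: x - z).
        rewrite scalerBr scalerA -rmorphM mulfV ?gt_eqF// scale1r.
        by rewrite rmorphN scaleNr opprK.
      rewrite rnormZ gtr0_norm//.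
      move=> /(ler_wpM2l (ltW nt)).
      by rewrite mulrBr mulrA mulfV ?gt_eqF//; lra.
    * have := c_le (Gscale t^-1 Gx).
      have -> : x + t%:C *: z = t%:C *: (t^-1%:C *: x + z).
        by rewrite scalerDr scalerA -rmorphM mulfV ?gt_eqF// scale1r.
      rewrite rnormZ gtr0_norm//.
      move=> /(ler_wpM2l (ltW t0)).
      by rewrite mulrBr mulrA mulfV ?gt_eqF//; lra.
  + case: w Gw => y b Gy; exists (x0, rnorm x0), 0; split.
      by have [_ _ +] := Gfun; apply; exact: Gy.
    by rewrite scale0r mul0r !addr0.
- by move=> [x a] Gx; exists (x, a), 0; rewrite scale0r mul0r !addr0.
- by exists c; exists (0, 0), 1; rewrite scale1r mul1r !add0r.
Qed.

End Extension.

Lemma real_hahn_banach : exists g : X -> R,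
  [/\ forall t x y, g (t%:C *: x + y) = t * g x + g y,
      forall x, g x <= rnorm x & g x0 = rnorm x0].
Proof.
have [G [Gfun Gmax]] := Zorn_bigcup bigcup_partial_functional.
have [Gadd Gle Gx0] := Gfun.
(* An empty [G] would be properly contained in the graph on the line through [x0], against
   maximality. *)
have Gn0 : G !=set0.
  apply: contrapT => G0; apply: Gmax line_partial_functional.
  split=> [w Gw|/(_ (x0, rnorm x0)) Gx]; first by case: G0; exists w.
  apply: G0; exists (x0, rnorm x0); apply: Gx.
  by exists 1; rewrite ?scale1r ?mul1r.
have Gtot x : exists a, G (x, a).
  have [H [Hfun GH [a Ha]]] := extend_partial_functional Gfun Gn0 x.
  exists a; apply: contrapT => Gxa; apply: Gmax Hfun.
  by split=> // /(_ _ Ha).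
have [g gP] := choice Gtot.
(* Single-valuedness follows from domination: [(0, a - g x)] and its negative lie in [G], and
   [|0| = 0]. *)
have Guniq x a : G (x, a) -> a = g x.
  move=> Gx; apply/eqP; rewrite eq_le.
  have := Gle _ _ (Gadd (-1) _ _ _ _ Gx (gP x)).
  have := Gle _ _ (Gadd (-1) _ _ _ _ (gP x) Gx).
  by rewrite rmorphN1 scaleN1r !mulN1r !addNr rnorm0; lra.
exists g; split=> [t x y|x|].
- by apply/esym/Guniq; exact: Gadd.
- exact: Gle.
- have [[x a] Gx] := Gn0; exact/esym/Guniq/Gx0/Gx.
Qed.

(** The real functional [g] is complexified as [l x = g x - i g (i x)]. The real part of [l x0] is
    [|x0|], so [l] can be divided by [l x0]; the crude bound [|l x| <= 2 |x|] suffices. *)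
Theorem hahn_banach : x0 != 0 ->
  exists2 l : X -> R[i]^o, bounded_linear l & l x0 = 1.
Proof.
move=> x0_neq0; have [g [gadd gle gx0]] := real_hahn_banach.
have g0 : g 0 = 0 by have := gadd 1 0 0; rewrite scale1r add0r; lra.
have gZ t x : g (t%:C *: x) = t * g x.
  by have := gadd t x 0; rewrite !addr0 g0 addr0.
have gD x y : g (x + y) = g x + g y.
  by have := gadd 1 x y; rewrite scale1r mul1r.
have gabs x : `|g x| <= rnorm x.
  have := gle (- x); rewrite -scaleN1r -[-1](rmorphN1 (real_complex R)) gZ.
  rewrite rmorphN1 scaleN1r rnormN mulN1r => gNx.
  by rewrite ler_norml gle andbT; lra.
pose l x : R[i]^o := g x -i* g ('i *: x).
have iiZ v : 'i *: ('i *: v) = (-1)%:C *: v :> X.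
  by rewrite scalerA -expr2 sqr_i rmorphN1.
have l_real t x y : l (t%:C *: x + y) = t%:C * l x + l y.
  have iZ : 'i *: (t%:C *: x) = t%:C *: ('i *: x) by rewrite !scalerA mulrC.
  rewrite /l scalerDr iZ !gadd.
  by apply/eqP; rewrite eq_complex /=; apply/andP; split; apply/eqP; ring.
have l_i x : l ('i *: x) = 'i * l x.
  rewrite /l iiZ gZ.
  by apply/eqP; rewrite eq_complex /=; apply/andP; split; apply/eqP; ring.
have llin : linear l.
  (* Complex linearity follows from real linearity and [l (i x) = i l x] by splitting [a] into real
     and imaginary parts. *)
  move=> a x y.
  have -> : a *: x + y =
      (complex.Re a)%:C *: x + ((complex.Im a)%:C *: ('i *: x) + y).
    by rewrite {1}[a]complexE scalerDl -addrA scalerA [_%:C * 'i]mulrC.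
  rewrite !l_real l_i addrA mulrA [_%:C * 'i]mulrC -mulrDl.
  by rewrite -complexE.
have lx0 : l x0 != 0.
  by rewrite eq_complex /= gx0 rnorm_eq0 negb_and x0_neq0.
have lbounded : bounded_linear l.
  apply: (@bounded_linear_rnorm _ _ _ _ 2) => // x.
  have -> : l x = (g x)%:C *: (1 : R[i]^o) +
      (- g ('i *: x))%:C *: ('i *: (1 : R[i]^o)).
    by apply/eqP; rewrite eq_complex /=; apply/andP; split; apply/eqP; ring.
  apply: le_trans (rnormD _ _) _; rewrite !rnormZ rnormZi normrN.
  have -> : rnorm (1 : R[i]^o) = 1 by rewrite /rnorm normr1.
  by have := gabs x; have := gabs ('i *: x); rewrite rnormZi; lra.
exists (fun x => (l x0)^-1 *: l x); last exact: mulVf.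
exact: bounded_linear_comp (bounded_linear_scale _ _) lbounded.
Qed.

End HahnBanach.

(** * Constant vector-valued functions *)

Section Constants.
Variables (R : realType) (A : anpair R) (admA : admissible A).

Lemma ev_cvg (X : completeNormedModType R[i]) (z : disc R)
    (f : nat -> vector_space A X) (g : vector_space A X) :
  f n @[n --> \oo] --> g -> ev (f n) z @[n --> \oo] --> ev g z.
Proof. exact: (bounded_linear_cvg (admissible_eval admA X z)). Qed.

(* For fixed [x], (a2) gives no bound uniform in [x]; the closed graph theorem,
   applicable by (a4), does. *)
Lemma constant_embedding (X : completeNormedModType R[i]) :
  exists2 J : X -> vector_space A X,
    bounded_linear J & forall x z, ev (J x) z = x.
Proof.
have [f1 f1E] := admissible_cst admA 1.
have /choice[J JE] x : exists f : vector_space A X, forall z, ev f z = x.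
  have [T _ TE] := admissible_tensor admA x.
  by exists (T f1) => z; rewrite TE f1E scale1r.
exists J => //; apply: closed_graph => [a x y|u x f ux Juf].
  by apply: ev_inj => z; rewrite ev_linear !JE.
(* Evaluation at [z] sends [J (u n)] to [u n], so by (a4) [u] converges to [ev f z] as well as to
   [x]. *)
apply: ev_inj => z; rewrite JE; apply: (@cvg_unique _ (@norm_hausdorff _ X)) ux.
have := ev_cvg (z := z) Juf; under eq_fun do rewrite JE.
exact.
Qed.

End Constants.

(** * Factorizations through the vector-valued operator *)

Section Factorizations.
Variables (R : realType) (X : completeNormedModType R[i]) (A B : anpair R).
Hypotheses (admA : admissible A) (admB : admissible B).
Variables (psi : disc R -> R[i]^o) (phi : disc R -> disc R).
Variable W : vector_space A X -> vector_space B X.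
Hypothesis WE : forall f z, ev (W f) z = psi z *: ev f (phi z).

Lemma identity_factorization : (exists z, psi z != 0) ->
  exists (J : X -> vector_space A X) (Q : vector_space B X -> X),
    [/\ bounded_linear J, bounded_linear Q & Q \o W \o J = id].
Proof.
move=> [z psiz]; have [J Jb JE] := constant_embedding admA X.
exists J, ((fun x => (psi z)^-1 *: x) \o (fun f => ev f z)); split=> //.
  apply: bounded_linear_comp; first exact: bounded_linear_scale.
  exact: admissible_eval.
by apply/funext => x /=; rewrite WE JE scalerA mulVf// scale1r.
Qed.

Lemma scalar_factorization : (exists x : X, x != 0) ->
  exists (S : scalar_space A -> vector_space A X)
         (Q : vector_space B X -> scalar_space B),
    [/\ bounded_linear S, bounded_linear Q &
        forall f z, ev ((Q \o W \o S) f) z = psi z *: ev f (phi z)].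
Proof.
move=> [x /hahn_banach[l lb lx]].
have [S Sb SE] := admissible_tensor admA x.
have [Q Qb QE] := admissible_dual admB lb.
exists S, Q; split=> // f z /=.
have [linl _] := lb.
(* As [l x = 1], applying [l] recovers the scalar coefficient of [x]. *)
have lZ a : l (a *: x) = a.
  have l0 : l 0 = 0 by have := linl (-1) x x; rewrite !scaleN1r !addNr.
  by rewrite -[a *: x]addr0 linl l0 addr0 lx [LHS]mulr1.
by rewrite QE WE SE scalerA lZ.
Qed.

End Factorizations.

(** For [X = 0] both vector-valued spaces vanish and the operator between them says nothing about
    the scalar one; hence [X_nontrivial]. Both parts follow from the factorizations, by stability of
    boundedness and of the ideal under composition. *)
Theorem proposition1 (R : realType) (X : completeNormedModType R[i])
    (X_nontrivial : exists x : X, x != 0)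
    (A B : anpair R) (admA : admissible A) (admB : admissible B)
    (psi : disc R -> R[i]^o) (psi_analytic : analytic psi)
    (psi_neq0 : exists z : disc R, psi z != 0)
    (phi : disc R -> disc R)
    (phi_analytic : analytic (fun z => \val (phi z) : R[i]^o)) :
  (wco_in psi phi
     (@bounded_linear R (vector_space A X) (vector_space B X)) ->
   wco_in psi phi (@bounded_linear R (scalar_space A) (scalar_space B)))
  /\
  (forall I : opclass R, operator_ideal I ->
   wco_in psi phi (I (vector_space A X) (vector_space B X)) ->
   I X X (fun x => x) /\
   wco_in psi phi (I (scalar_space A) (scalar_space B))).
Proof.
have scalar := scalar_factorization admA admB.
split=> [[W Wb WE]|I idealI [W IW WE]].
  have [S [Q [Sb Qb QWS]]] := scalar _ _ _ _ WE X_nontrivial.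
  by exists (Q \o W \o S) => //; do 2 apply: bounded_linear_comp => //.
split.
  have [J [Q [Jb Qb <-]]] := identity_factorization admA admB WE psi_neq0.
  exact: ideal_comp.
have [S [Q [Sb Qb QWS]]] := scalar _ _ _ _ WE X_nontrivial.
by exists (Q \o W \o S) => //; exact: ideal_comp.
Qed.
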